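(* Let $\mathbf{F}$ be a field of characteristic $3$, let $r\in\mathbf{N}$, let $\lambda=(\lambda_1,\lambda_2)$ be a partition of $r$ (with $\lambda_2\ge 0$), and put $m=\lambda_1-\lambda_2$. Then the set \[\{\,e_{m,g} : g\in\mathbf{N}_0,\ g\le\lambda_2,\ B(m,g)\not\equiv 0 \pmod 3\,\}\] is a complete set of primitive orthogonal idempotents of $S_\mathbf{F}(\lambda)$.
   Context: For a partition $\lambda=(\lambda_1,\lambda_2)$ of $r$ with at most two parts, $M^\lambda$ denotes the $\mathbf{F}S_r$-permutation module on the cosets of the Young subgroup $S_{\lambda_1}\times S_{\lambda_2}$, and $S_\mathbf{F}(\lambda)=\operatorname{End}_{\mathbf{F}S_r}(M^\lambda)$. It is known that $S_\mathbf{F}(\lambda)$ is a commutative $\mathbf{F}$-algebra with basis $b(0),b(1),\dots,b(\lambda_2)$ (where $b(i)=1_\lambda f^{(i)}e^{(i)}1_\lambda$ in the Schur algebra), with $b(0)=\mathbf{1}$ the identity, and multiplication \[b(i)b(j)=\sum_{h=\max\{i,j\}}^{i+j}\binom{h}{i}\binom{h}{j}\binom{m+i+j}{i+j-h}b(h),\qquad m=\lambda_1-\lambda_2,\] with the convention $b(a)=0$ for $a>\lambda_2$. For $m,g\in\mathbf{N}_0$ set $B(m,g)=\binom{m+2g}{g}$. Given $m,g$ with $B(m,g)\not\equiv0\pmod 3$, write $m+2g=\sum_u (m+2g)_u3^u$ and $g=\sum_u g_u3^u$ in base $3$ and define index sets $I^{(0)}=\{u: g_u=0,(m+2g)_u=0\}$,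 $J^{(0)}=\{u:g_u=1,(m+2g)_u=2\}$, $I^{(1)}=\{u:g_u=0,(m+2g)_u=1\}$, $J^{(1)}=\{u:g_u=2,(m+2g)_u=2\}$, $I^{(2)}=\{u:g_u=0,(m+2g)_u=2\}$, $J^{(2)}=\{u:g_u=1,(m+2g)_u=1\}$. Define the element of $S_\mathbf{F}(\lambda)$ (for any $\lambda$ with $\lambda_1-\lambda_2=m$) \[e_{m,g}=\prod_{u\in I^{(0)}}(\mathbf{1}+b(3^u)-b(2\cdot3^u))\prod_{u\in J^{(0)}}(b(2\cdot3^u)-b(3^u))\prod_{u\in I^{(1)}}(\mathbf{1}-b(2\cdot3^u))\prod_{u\in J^{(1)}}b(2\cdot3^u)\prod_{u\in I^{(2)}}(\mathbf{1}-b(3^u)+b(2\cdot3^u))\prod_{u\in J^{(2)}}(b(3^u)-b(2\cdot3^u)),\] using the convention $b(a)=0$ for $a>\lambda_2$ (so all but finitely many factors equal $\mathbf{1}$). *)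

(* Defs.v *)
From HB Require Import structures.
From mathcomp Require Import all_boot all_order all_algebra.
Set Implicit Arguments. Unset Strict Implicit. Unset Printing Implicit Defensive.
Import GRing.Theory.
Local Open Scope ring_scope.

(* The algebra S_F(lambda), lambda = (l1,l2), m = l1 - l2, realised on its
   basis b(0),...,b(l2): an element is the row vector of its coordinates. *)
Section SchurEnd.
Variable F : fieldType.
Variables l2 m : nat.

Definition SF := 'rV[F]_(l2.+1).

Definition bcoef (i j h : nat) : nat :=
  if (h <= i + j)%N then ('C(h, i) * 'C(h, j) * 'C(m + i + j, i + j - h))%N
  else 0%N.

(* b(a); equals 0 when a > l2 *)
Definition bb (a : nat) : SF := \row_(h < l2.+1) ((h : nat) == a)%:R.

Definition sone : SF := bb 0.

Definition smul (x y : SF) : SF :=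
  \row_(h < l2.+1) \sum_(i < l2.+1) \sum_(j < l2.+1)
     x 0 i * y 0 j * (bcoef i j h)%:R.

Definition is_idem (e : SF) : Prop := smul e e = e.

Definition primitive_idem (e : SF) : Prop :=
  [/\ is_idem e, e != 0 &
      forall f1 f2 : SF, is_idem f1 -> is_idem f2 ->
        smul f1 f2 = 0 -> smul f2 f1 = 0 -> e = f1 + f2 ->
        f1 = 0 \/ f2 = 0].

Definition dig3 (u n : nat) : nat := ((n %/ 3 ^ u) %% 3)%N.

Definition efactor (g u : nat) : SF :=
  let a := dig3 u (m + 2 * g) in
  let c := dig3 u g in
  let p := bb (3 ^ u) in
  let q := bb (2 * 3 ^ u) in
  if (c == 0%N) && (a == 0%N) then sone + p - q
  else if (c == 1%N) && (a == 2%N) then q - p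
  else if (c == 0%N) && (a == 1%N) then sone - q
  else if (c == 2%N) && (a == 2%N) then q
  else if (c == 0%N) && (a == 2%N) then sone - p + q
  else if (c == 1%N) && (a == 1%N) then p - q
  else sone.

(* e_{m,g}: product over all u; for u >= m + 2g + l2 + 1 we have
   3^u > l2 and 3^u > m + 2g, so digits are 0 and the factor is
   1 + b(3^u) - b(2 3^u) = 1 (those b's vanish). *)
Definition e_mg (g : nat) : SF :=
  \big[smul/sone]_(u < m + 2 * g + l2 + 1) efactor g u.

End SchurEnd.

(* Main.v *)
Require Import Defs.
From HB Require Import structures.
From mathcomp Require Import all_boot all_order all_algebra.
From mathcomp Require Import zify ring.
Import GRing.Theory.
Local Open Scope ring_scope.

(* Over the integers [b(i)] acts on the weight-[m] line of the Weyl module of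
   highest weight [m + 2g] as the scalar [C(g, i) C(m + g + i, i)]; these
   characters separate elements, so the multiplication is associative.
   In characteristic 3, Lucas' theorem gives [b(s) b(3i) = b(3i + s)] for
   [s < 3], and expresses [b(3i) b(3j)] through the structure constants for
   [m / 3] plus a correction by an element [t] of the span of [b(1), b(2)].  The
   last-digit factor [e] of [e_{m, 3h+s}] makes [t] act as 0 or 1, and Pascal's
   rule then shows that [b(i) |-> e b(3i)] is multiplicative from the algebra
   with parameters [(m + 2s) / 3] and [l2 / 3]; it sends [e_{(m + 2s) / 3, h}] to
   [e_{m, 3h+s}].  Idempotency, orthogonality and completeness follow by
   induction on [l2].  The leading term of [e_{m,g}] is a nonzero multiple of
   [b(g)], and large Frobenius powers of any element act on it as scalars, so it
   is primitive. *)

Set Implicit Arguments. Unset Strict Implicit. Unset Printing Implicit Defensive.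

(** * Characters of the integral algebra and associativity *)

(* The eigenvalue of [b(i)] on the weight-[m] line in highest weight [m + 2g]. *)
Definition bchar (m i g : nat) : int := ('C(g, i) * 'C(m + g + i, i))%N%:Z.

Lemma mulz_bin_diag (n k : nat) :
  (k.+1)%:Z * 'C(n, k.+1)%:Z = (n%:Z - k%:Z) * 'C(n, k)%:Z.
Proof.
case: (leqP k n) => [le_kn|lt_nk]; last by rewrite !bin_small ?mulr0 // ltnW.
by rewrite subzn // -!PoszM mul_bin_left mulnC.
Qed.

(** Passing from [i] to [i + 1] multiplies the character by [(g - i) (m + g + i + 1) / (i + 1) ^ 2],
    and this numerator equals [g (m + g + 1) - i (i + m + 1)], whose first term is [bchar m 1 g]. *)
Lemma bchar_rec (m i g : nat) :
  bchar m 1 g * bchar m i g =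
  (i.+1)%:Z ^+ 2 * bchar m i.+1 g + i%:Z * (i%:Z + m%:Z + 1) * bchar m i g.
Proof.
rewrite /bchar !PoszM !bin1.
have H1 := mulz_bin_diag g i.
have H2 : (i.+1)%:Z * 'C(m + g + i.+1, i.+1)%:Z =
          (m%:Z + g%:Z + i%:Z + 1) * 'C(m + g + i, i)%:Z.
  by rewrite -PoszM addnS -mul_bin_diag PoszM; congr (_ * _); lia.
rewrite [X in X + _](_ : _ = ((i.+1)%:Z * 'C(g, i.+1)%:Z) *
  ((i.+1)%:Z * 'C(m + g + i.+1, i.+1)%:Z)); last by ring.
rewrite H1 H2 !PoszD; ring.
Qed.

Lemma bcoef_gt (m i j h : nat) : (i + j < h)%N -> bcoef m i j h = 0%N.
Proof. by rewrite /bcoef ltnNge => /negbTE->. Qed.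

Lemma bcoef_small (m i j h : nat) : (h < i)%N || (h < j)%N -> bcoef m i j h = 0%N.
Proof.
rewrite /bcoef; case: ifP => // _ /orP[]/bin_small->; by rewrite ?mul0n ?muln0.
Qed.

Lemma bcoefC (m i j h : nat) : bcoef m i j h = bcoef m j i h.
Proof. by rewrite /bcoef addnC (addnAC m) (mulnC 'C(h, i)). Qed.

Lemma bcoef0 (m j h : nat) : bcoef m 0 j h = (h == j).
Proof.
case: (ltngtP h j) => [lt|gt|->]; first by rewrite bcoef_small ?lt ?orbT.
  by rewrite bcoef_gt.
by rewrite /bcoef leqnn bin0 binn subnn bin0.
Qed.

(* The coefficient of [b(l)] in [(b(1) b(i)) b(j) = b(1) (b(i) b(j))]. *)
Lemma bcoef_rec (m i j l : nat) :
  (i.+1)%:Z ^+ 2 * (bcoef m i.+1 j l)%:Z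
    + i%:Z * (i%:Z + m%:Z + 1) * (bcoef m i j l)%:Z =
  l%:Z ^+ 2 * (if l is l'.+1 then bcoef m i j l' else 0%N)%:Z
    + l%:Z * (l%:Z + m%:Z + 1) * (bcoef m i j l)%:Z.
Proof.
case: (ltnP (i + j).+1 l) => [lt|le].
  case: l lt => // l lt; rewrite !bcoef_gt ?mulr0 //; lia.
(* Both factors [l] are absorbed through [l C(l - 1, k) = (l - k) C(l, k)], for [k = i] and
   [k = j]. *)
have T3 : l%:Z ^+ 2 * (if l is l'.+1 then bcoef m i j l' else 0%N)%:Z =
   (l%:Z - i%:Z) * (l%:Z - j%:Z) * 'C(l, i)%:Z * 'C(l, j)%:Z
     * 'C(m + i + j, (i + j).+1 - l)%:Z.
  case: l le => [|l] le.
    rewrite mulr0; case: i le => [|i] le; first by rewrite subrr !mul0r.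
    by rewrite bin0n mulr0 !mul0r.
  rewrite /bcoef -ltnS le subSS !PoszM.
  have H k : l.+1%:Z * 'C(l, k)%:Z = (l.+1%:Z - k%:Z) * 'C(l.+1, k)%:Z.
    case: (leqP k l.+1) => lk; last by rewrite !bin_small ?mulr0 // ltnW.
    by rewrite subzn // -!PoszM mul_bin_down.
  transitivity ((l.+1%:Z * 'C(l, i)%:Z) * (l.+1%:Z * 'C(l, j)%:Z) *
    'C(m + i + j, i + j - l)%:Z); first by ring.
  by rewrite !H; ring.
have T1 : (i.+1)%:Z ^+ 2 * (bcoef m i.+1 j l)%:Z =
  (i.+1)%:Z * (l%:Z - i%:Z) * 'C(l, i)%:Z * 'C(l, j)%:Z
     * 'C((m + i + j).+1, (i + j).+1 - l)%:Z.
  rewrite /bcoef !addSn le !PoszM addnS addSn -(mulrA i.+1%:Z _ 'C(l, i)%:Z).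
  by rewrite -mulz_bin_diag; ring.
rewrite T1 T3.
move: le; rewrite leq_eqVlt => /orP[/eqP ->|lt].
  rewrite bcoef_gt // !mulr0 !addr0 subnn !bin0.
  rewrite (_ : (i + j).+1%:Z - j%:Z = i.+1%:Z); last by lia.
  by ring.
rewrite /bcoef -ltnS lt !PoszM subSn // binS PoszD.
have H := mulz_bin_diag (m + i + j) (i + j - l).
rewrite (_ : (m + i + j)%:Z - (i + j - l)%:Z = m%:Z + l%:Z) in H; last by lia.
(* With [D = i + j - l], this form of [l - j] makes the difference of the two sides a multiple of
   the absorption identity [H]. *)
have E : l%:Z - j%:Z = i.+1%:Z - (i + j - l).+1%:Z by lia.
rewrite E -(addn1 i) PoszD.
apply/eqP; rewrite -subr_eq0; apply/eqP.
set c1 := 'C(l, i)%:Z; set c2 := 'C(l, j)%:Z; set D := (_ - _)%N in H *.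
set u := 'C(_, D.+1)%:Z in H *; set v := 'C(_, D)%:Z in H *.
transitivity ((l%:Z - i%:Z) * c1 * c2 * (D.+1%:Z * u - (m%:Z + l%:Z) * v)).
  by ring.
by rewrite H subrr mulr0.
Qed.

Lemma bchar_gt (m i g : nat) : (g < i)%N -> bchar m i g = 0.
Proof. by move=> lt; rewrite /bchar bin_small. Qed.

(** Induction on [i]: multiplying by [bchar m 1 g] raises the index on both sides, [bcoef_rec]
    matches the coefficients, and [(i + 1) ^ 2] cancels over the integers. *)
Lemma bcharM (m i j g n : nat) : (g < n)%N ->
  bchar m i g * bchar m j g = \sum_(h < n) (bcoef m i j h)%:Z * bchar m h g.
Proof.
move=> gn; elim: i => [|i IH].
  have -> : bchar m 0 g = 1 by rewrite /bchar !bin0.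
  rewrite mul1r; case: (ltnP j n) => [jn|nj].
    rewrite (bigD1 (Ordinal jn)) //= bcoef0 eqxx mul1r big1 ?addr0 // => h.
    by rewrite -val_eqE /= bcoef0 => /negbTE->; rewrite mul0r.
  rewrite [LHS]bchar_gt ?(leq_trans gn) // big1 // => h _.
  by rewrite bcoef0 ltn_eqF ?mul0r // (leq_trans (ltn_ord h)).
apply: (@mulfI _ (i.+1%:Z ^+ 2)) => //.
have R : i.+1%:Z ^+ 2 * bchar m i.+1 g =
    (bchar m 1 g - i%:Z * (i%:Z + m%:Z + 1)) * bchar m i g.
  by rewrite mulrBl bchar_rec addrK.
rewrite mulrA R -mulrA IH mulrBl !mulr_sumr.
pose f l := l%:Z ^+ 2 * (if l is l'.+1 then bcoef m i j l' else 0%N)%:Z * bchar m l g.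
(* The shift loses nothing: [f 0] carries the factor [0 ^ 2], and [f n] vanishes because [g < n]. *)
have S : \sum_(h < n) f h.+1 = \sum_(h < n) f h.
  transitivity (f 0%N + \sum_(h < n) f h.+1); first by rewrite (_ : f 0%N = 0) ?add0r // /f mulr0 mul0r.
  rewrite -(big_ord_recl n (fun h => f h)) big_ord_recr /= [X in _ + X](_ : _ = 0) ?addr0 //.
  by rewrite /f bchar_gt ?mulr0.
transitivity (\sum_(h < n) f h + \sum_(h < n) (h%:Z * (h%:Z + m%:Z + 1) *
   (bcoef m i j h)%:Z * bchar m h g) -
   \sum_(h < n) (i%:Z * (i%:Z + m%:Z + 1) * (bcoef m i j h)%:Z * bchar m h g)).
  congr (_ - _); last by apply: eq_bigr => h _; rewrite !mulrA.
  rewrite -S -big_split /=; apply: eq_bigr => h _.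
  rewrite mulrCA bchar_rec /f; ring.
rewrite -big_split -sumrB /=; apply: eq_bigr => h _.
have := bcoef_rec m i j h; rewrite /f.
move: (if _ is _.+1 then _ else _) => c R1.
rewrite mulrA -!mulrDl -mulrBl -R1 addrK //.
Qed.

(** The matrix of the [bchar m l g] is triangular, zero for [l > g], with nonzero diagonal entries
    [C(m + 2l, l)]. *)
Lemma bchar_free (m n : nat) (d : nat -> int) :
  (forall g, (g < n)%N -> \sum_(l < n) d l * bchar m l g = 0) ->
  forall l, (l < n)%N -> d l = 0.
Proof.
move=> H l; have [k] := ubnP l; elim: k l => // k IH l lk ln.
have := H l ln; rewrite (bigD1 (Ordinal ln)) //= big1 ?addr0 => [|i].
  move/eqP; rewrite mulf_eq0 => /orP[/eqP //|].
  rewrite /bchar binn mul1n eqz_nat -leqn0 leqNgt bin_gt0; lia.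
rewrite -val_eqE /= neq_ltn => /orP[il|li].
  by rewrite IH ?mul0r //; lia.
by rewrite bchar_gt ?mulr0.
Qed.

(** Both sums are coefficients of the same product of three characters, so [bchar_free] identifies
    them. At [g < n] only indices below [n] contribute, so truncation is harmless. *)
Lemma bcoefA (m i j k l n : nat) : (l < n)%N ->
  (\sum_(h < n) bcoef m i j h * bcoef m h k l =
   \sum_(h < n) bcoef m j k h * bcoef m i h l)%N.
Proof.
move=> ln; apply/eqP; rewrite -eqz_nat -subr_eq0; apply/eqP.
pose d l := (\sum_(h < n) bcoef m i j h * bcoef m h k l)%N%:Z -
  (\sum_(h < n) bcoef m j k h * bcoef m i h l)%N%:Z.
apply: (@bchar_free m n d) ln => g gn; rewrite /d.
under eq_bigr do rewrite mulrBl.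
have natsum (f : 'I_n -> nat) : (\sum_(h < n) f h)%N%:Z = \sum_(h < n) (f h)%:Z.
  by rewrite (big_morph Posz PoszD (erefl 0%:Z)).
rewrite sumrB; apply/eqP; rewrite subr_eq0; apply/eqP.
transitivity (bchar m i g * bchar m j g * bchar m k g).
  rewrite (bcharM _ _ _ gn) mulr_suml.
  under [RHS]eq_bigr do rewrite -mulrA (bcharM _ _ _ gn) mulr_sumr.
  rewrite exchange_big /=; apply: eq_bigr => l' _.
  rewrite natsum mulr_suml; apply: eq_bigr => h _.
  by rewrite PoszM mulrA.
rewrite -mulrA (bcharM m j k gn) mulr_sumr.
under eq_bigr do rewrite mulrCA (bcharM _ _ _ gn) mulr_sumr.
rewrite exchange_big /=; apply: eq_bigr => l' _.
rewrite natsum mulr_suml; apply: eq_bigr => h _.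
by rewrite PoszM mulrA.
Qed.

(** * The commutative algebra structure *)

(* [SF F l2] does not mention [m], so the ring structure needs an alias that does. *)
Definition schur (F : fieldType) (l2 m : nat) : Type := SF F l2.
HB.instance Definition _ (F : fieldType) l2 m := GRing.Lmodule.on (schur F l2 m).

Section SchurRing.
Variables (F : fieldType) (l2 m : nat).
Implicit Types x y z : SF F l2.

Lemma smulE x y (h : 'I_l2.+1) : smul m x y 0 h =
  \sum_(i < l2.+1) \sum_(j < l2.+1) x 0 i * y 0 j * (bcoef m i j h)%:R.
Proof. by rewrite mxE. Qed.

Lemma smulC x y : smul m x y = smul m y x.
Proof.
apply/rowP => h; rewrite !smulE exchange_big /=.
apply: eq_bigr => i _; apply: eq_bigr => j _.
by rewrite bcoefC (mulrC (x 0 j)).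
Qed.

Lemma smulDl x y z : smul m (x + y) z = smul m x z + smul m y z.
Proof.
apply/rowP => h; rewrite [RHS]mxE !smulE -big_split /=; apply: eq_bigr => i _.
rewrite -big_split /=; apply: eq_bigr => j _.
by rewrite mxE !mulrDl.
Qed.

Lemma smul_scale c x y : c *: smul m x y = smul m (c *: x) y.
Proof.
apply/rowP => h; rewrite [LHS]mxE !smulE mulr_sumr; apply: eq_bigr => i _.
by rewrite mulr_sumr; apply: eq_bigr => j _; rewrite mxE !mulrA.
Qed.

Lemma smul1 x : smul m (sone F l2) x = x.
Proof.
apply/rowP => h; rewrite smulE big_ord_recl /= [X in _ + X]big1 ?addr0 => [|i _]; last first.
  by rewrite big1 // => j _; rewrite mxE !mul0r.
rewrite (bigD1 h) //= big1 => [|j].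
  by rewrite mxE bcoef0 !eqxx mulr1 mul1r addr0.
by rewrite -val_eqE /= bcoef0 eq_sym => /negbTE->; rewrite mulr0.
Qed.

Lemma smulA x y z : smul m x (smul m y z) = smul m (smul m x y) z.
Proof.
apply/rowP => l; rewrite !smulE.
pose T i j k (c : nat) := x 0 i * y 0 j * z 0 k * c%:R.
transitivity (\sum_(i < l2.+1) \sum_(j < l2.+1) \sum_(k < l2.+1)
   T i j k (\sum_(h < l2.+1) bcoef m j k h * bcoef m i h l)%N).
  apply: eq_bigr => i _.
  under eq_bigr => h _ do rewrite smulE mulr_sumr mulr_suml.
  rewrite exchange_big /=; apply: eq_bigr => j _.
  under eq_bigr => h _ do rewrite mulr_sumr mulr_suml.
  rewrite exchange_big /=; apply: eq_bigr => k _.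
  rewrite /T natr_sum mulr_sumr; apply: eq_bigr => h _.
  by rewrite natrM !mulrA.
transitivity (\sum_(k < l2.+1) \sum_(i < l2.+1) \sum_(j < l2.+1)
   T i j k (\sum_(h < l2.+1) bcoef m i j h * bcoef m h k l)%N); last first.
  rewrite [RHS]exchange_big /=; apply: eq_bigr => k _.
  under [RHS]eq_bigr => h _ do rewrite smulE -mulrA mulr_suml.
  rewrite [RHS]exchange_big /=; apply: eq_bigr => i _.
  under [RHS]eq_bigr => h _ do rewrite mulr_suml.
  rewrite [RHS]exchange_big /=; apply: eq_bigr => j _.
  rewrite /T natr_sum mulr_sumr; apply: eq_bigr => h _.
  rewrite natrM; ring.
rewrite [RHS]exchange_big; apply: eq_bigr => i _.
rewrite [RHS]exchange_big; apply: eq_bigr => j _; apply: eq_bigr => k _.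
by rewrite bcoefA // bcoefA.
Qed.

Lemma sone_neq0 : sone F l2 != 0.
Proof.
apply/eqP => /rowP /(_ ord0); rewrite !mxE eqxx => /eqP; apply/negP.
exact: oner_neq0.
Qed.

End SchurRing.

HB.instance Definition _ (F : fieldType) l2 m :=
  GRing.Zmodule_isComNzRing.Build (schur F l2 m)
    (@smulA F l2 m) (@smulC F l2 m) (@smul1 F l2 m) (@smulDl F l2 m)
    (sone_neq0 F l2).
HB.instance Definition _ (F : fieldType) l2 m :=
  GRing.Lmodule_isLalgebra.Build F (schur F l2 m) (@smul_scale F l2 m).
HB.instance Definition _ (F : fieldType) l2 m :=
  GRing.Lalgebra_isComAlgebra.Build F (schur F l2 m).

(** * Lucas' theorem at 3 and the basis in characteristic 3 *)

Lemma lucas3 (a b x y : nat) : (x < 3)%N -> (y < 3)%N ->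
  'C(3 * a + x, 3 * b + y) = 'C(a, b) * 'C(x, y) %[mod 3].
Proof.
move=> lx ly; elim: a b => [|a IH] [|b].
- by rewrite mul1n.
- by rewrite bin0n mul0n bin_small //; lia.
- have := IH 0%N; rewrite muln0 !add0n !bin0 !mul1n => <-.
  rewrite (_ : (3 * a.+1 + x = (3 * a + x).+3)%N); last lia.
  case: y ly {IH} => [|[|[|//]]] _; first by rewrite !bin0.
    by rewrite !bin1; lia.
  rewrite !binS !bin1 !bin0; lia.
(* Pascal's rule applied three times gives [C(n + 3, k + 3) = C(n, k) + C(n, k + 3)] mod 3. *)
rewrite (_ : (3 * a.+1 + x = (3 * a + x).+3)%N); last lia.
have := IH b; have := IH b.+1.
rewrite (_ : (3 * b.+1 + y = (3 * b + y).+3)%N); last lia.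
rewrite !binS mulnDl; lia.
Qed.

Section Basis.
Variables (F : fieldType) (l2 m : nat).
Notation A := (schur F l2 m).
Implicit Types x y : A.

Definition sb (i : nat) : A := bb F l2 i.

(** Extension by zero to all naturals keeps digit arithmetic on indices, such as [3 * h + t], free
    of ordinals. *)
Definition cf x (h : nat) : F := if (h <= l2)%N then (x : SF F l2) 0 (inord h) else 0.

Lemma cfE x (h : 'I_l2.+1) : cf x h = (x : SF F l2) 0 h.
Proof. by rewrite /cf -ltnS ltn_ord inord_val. Qed.

Lemma cf_gt x h : (l2 < h)%N -> cf x h = 0.
Proof. by rewrite /cf ltnNge => /negbTE->. Qed.

Lemma cf_inj x y : (forall h, (h <= l2)%N -> cf x h = cf y h) -> x = y.
Proof. by move=> H; apply/rowP => h; rewrite -!cfE H // -ltnS. Qed.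

Lemma cf0 h : cf 0 h = 0.
Proof. by rewrite /cf mxE; case: ifP. Qed.

Lemma cfD x y h : cf (x + y) h = cf x h + cf y h.
Proof. by rewrite /cf mxE; case: ifP => //; rewrite addr0. Qed.

Lemma cfZ c x h : cf (c *: x) h = c * cf x h.
Proof. by rewrite /cf mxE; case: ifP => //; rewrite mulr0. Qed.

Lemma cfMn x n h : cf (x *+ n) h = cf x h *+ n.
Proof. by rewrite -scaler_nat cfZ mulr_natl. Qed.

Lemma cf_sum I (r : seq I) P (f : I -> A) h :
  cf (\sum_(i <- r | P i) f i) h = \sum_(i <- r | P i) cf (f i) h.
Proof. exact: (big_morph (cf^~ h) (fun x y => cfD x y h) (cf0 h)). Qed.

Lemma cf_sb i h : (h <= l2)%N -> cf (sb i) h = (h == i)%:R.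
Proof. by move=> hl; rewrite /cf hl mxE inordK. Qed.

Lemma sb_gt i : (l2 < i)%N -> sb i = 0.
Proof.
by move=> li; apply: cf_inj => h hl; rewrite cf_sb // cf0 ltn_eqF // (leq_ltn_trans hl).
Qed.

Lemma sb0 : sb 0 = 1. Proof. by []. Qed.

Lemma sb_expand N x : (l2 < N)%N -> x = \sum_(i < N) cf x i *: sb i.
Proof.
move=> lN; apply: cf_inj => h hl; rewrite cf_sum.
rewrite (bigD1 (Ordinal (leq_ltn_trans hl lN))) //= cfZ cf_sb // eqxx mulr1.
rewrite [X in _ + X]big1 ?addr0 // => i; rewrite -val_eqE /= cfZ cf_sb // eq_sym => /negbTE->.
by rewrite mulr0.
Qed.

Lemma cf_sbM i j h : (h <= l2)%N -> cf (sb i * sb j) h = (bcoef m i j h)%:R.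
Proof.
move=> hl; case: (leqP i l2) => il; last first.
  by rewrite sb_gt // mul0r cf0 bcoef_small // (leq_ltn_trans hl il).
case: (leqP j l2) => jl; last first.
  by rewrite (@sb_gt j) // mulr0 cf0 bcoef_small // (leq_ltn_trans hl jl) orbT.
rewrite {1}/cf hl smulE.
rewrite (bigD1 (Ordinal (il : (i < l2.+1)%N))) //= [X in _ + X]big1 => [|k]; last first.
  rewrite -val_eqE /= => /negbTE ki; rewrite big1 // => l _.
  by rewrite mxE ki !mul0r.
rewrite addr0 (bigD1 (Ordinal (jl : (j < l2.+1)%N))) //= [X in _ + X]big1 => [|k]; last first.
  rewrite -val_eqE /= => /negbTE ki.
  by rewrite [X in _ * X * _]mxE ki mulr0 mul0r.
by rewrite !mxE /= !eqxx !mul1r !addr0 inordK.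
Qed.

(** Terms past [l2] vanish with [sb], terms past [i + j] with [bcoef]; the free bound [N] lets later
    sums be cut into blocks of three. *)
Lemma sbM i j N : (minn l2 (i + j) < N)%N ->
  sb i * sb j = \sum_(h < N) sb h *+ bcoef m i j h.
Proof.
move=> lN; apply: cf_inj => h hl; rewrite cf_sbM // cf_sum.
case: (ltnP h N) => hN.
  rewrite (bigD1 (Ordinal hN)) //= cfMn cf_sb // eqxx big1 ?addr0 // => k.
  by rewrite -val_eqE /= cfMn cf_sb // eq_sym => /negbTE->; rewrite mul0rn.
rewrite bcoef_gt; last by lia.
rewrite big1 // => k _; rewrite cfMn cf_sb // gtn_eqF ?mul0rn //.
exact: leq_trans hN.
Qed.

Hypothesis char3 : (3 \in [pchar F])%N.

Lemma mulr3n_eq0 (V : lmodType F) (v : V) : v *+ 3 = 0.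
Proof. by rewrite -scaler_nat pcharf0 // scale0r. Qed.

Lemma mulrn_mod3 (V : lmodType F) (v : V) n n' : n = n' %[mod 3] -> v *+ n = v *+ n'.
Proof.
move=> E; rewrite (divn_eq n 3) (divn_eq n' 3) E !mulrnDr !(mulnC _ 3%N) !mulrnA.
by rewrite mulr3n_eq0 !mul0rn.
Qed.

Lemma schur_pchar : (3 \in [pchar A])%N.
Proof. by rewrite inE /= -scaler_nat pcharf0 // scale0r eqxx. Qed.

(** For [h = 3 * i + t] with [t < s], Lucas kills [C(h, s)]; at [h = 3 * i + s] every binomial is 1
    mod 3. *)
Lemma bcoef_digit s i h : (s < 3)%N -> bcoef m s (3 * i) h = (h == 3 * i + s)%N %[mod 3].
Proof.
move=> s3; rewrite /bcoef addnC.
case: (ltngtP h (3 * i + s)%N) => // [lt|->].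
  case: (ltnP h (3 * i)) => hi; first by rewrite (bin_small hi) muln0.
  have [t th ts] : exists2 t, h = (3 * i + t)%N & (t < s)%N.
    by exists (h - 3 * i)%N; lia.
  have := @lucas3 i 0 t s; rewrite muln0 add0n (bin_small ts) muln0 -th.
  by move=> H; rewrite -mulnA -modnMml H ?mul0n //; lia.
rewrite subnn bin0 muln1.
have := @lucas3 i 0 s s; rewrite muln0 add0n binn bin0 => H1.
have := @lucas3 i i s 0; rewrite addn0 binn bin0 => H2.
by rewrite -modnMml -modnMmr H1 // H2.
Qed.

Lemma sb_digitM s i : (s < 3)%N -> sb s * sb (3 * i) = sb (3 * i + s).
Proof.
move=> s3; rewrite (@sbM _ _ (maxn l2 (3 * i + s)).+1); last by lia.
under eq_bigr => h _ do rewrite (mulrn_mod3 _ (bcoef_digit _ _ s3)).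
have lt : (3 * i + s < (maxn l2 (3 * i + s)).+1)%N by lia.
rewrite (bigD1 (Ordinal lt)) //= eqxx big1 ?addr0 // => h.
by rewrite -val_eqE /= => /negbTE->.
Qed.

End Basis.

(** * Structure constants at multiples of 3 *)

Lemma big_ord_mul3 (V : nmodType) n (f : nat -> V) :
  \sum_(h < 3 * n) f h =
  \sum_(h < n) (f (3 * h)%N + f (3 * h + 1)%N + f (3 * h + 2)%N).
Proof.
elim: n => [|n IH]; first by rewrite !big_ord0.
rewrite [RHS]big_ord_recr -IH (_ : (3 * n.+1 = (3 * n).+3)%N); last by lia.
by rewrite !big_ord_recr /= addn1 addn2 !addrA.
Qed.

(** The Pascal correction when [m] grows by one. The guard is strict because at [h = i + j] the
    predecessor of 0 would wrongly contribute [C(_, 0) = 1]. *)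
Definition bcoef_shift (m i j h : nat) : nat :=
  if (h < i + j)%N then ('C(h, i) * 'C(h, j) * 'C(m + i + j, (i + j - h).-1))%N
  else 0%N.

Lemma bcoefSm m i j h : bcoef m.+1 i j h = (bcoef m i j h + bcoef_shift m i j h)%N.
Proof.
rewrite /bcoef /bcoef_shift; case: ltngtP => // [lt|->].
  by rewrite -mulnDr addSn addSn -[(i + j - h)%N]prednK ?subn_gt0.
by rewrite subnn !bin0 addn0.
Qed.

Lemma eqn_modM d a a' b b' :
  a = a' %[mod d] -> b = b' %[mod d] -> a * b = a' * b' %[mod d].
Proof. by move=> Ha Hb; rewrite -modnMm Ha Hb modnMm. Qed.

Lemma bcoef_mul3 m i j h :
  bcoef m (3 * i) (3 * j) (3 * h) = bcoef (m %/ 3) i j h %[mod 3].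
Proof.
rewrite /bcoef -mulnDr leq_mul2l /=; case: ifP => // _.
have B k : 'C(3 * h, 3 * k) = 'C(h, k) %[mod 3].
  by have := @lucas3 h k 0 0 isT isT; rewrite !addn0 bin0 muln1.
have := @lucas3 (m %/ 3 + i + j) (i + j - h) (m %% 3) 0 (ltn_pmod m (isT : 0 < 3)%N) isT.
rewrite addn0 bin0 muln1 (_ : (3 * _ + _ = m + 3 * i + 3 * j)%N); last by lia.
rewrite (_ : (3 * (i + j - h) = 3 * (i + j) - 3 * h)%N); last by lia.
by move=> H; do !apply: eqn_modM.
Qed.

(** Subtracting [3 * h + s] from [3 * (i + j)] borrows: the quotient is [i + j - h - 1] and the last
    digit [3 - s]. *)
Lemma bcoef_mul3_digit m i j h s : (0 < s < 3)%N ->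
  bcoef m (3 * i) (3 * j) (3 * h + s) =
  (bcoef_shift (m %/ 3) i j h * 'C(m %% 3, 3 - s))%N %[mod 3].
Proof.
move=> /andP[s0 s3]; rewrite /bcoef /bcoef_shift.
have -> : (3 * h + s <= 3 * i + 3 * j)%N = (h < i + j)%N by lia.
case: ifP => // hij.
have B k : 'C(3 * h + s, 3 * k) = 'C(h, k) %[mod 3].
  by have := @lucas3 h k s 0 s3 isT; rewrite !addn0 bin0 muln1.
have s3' : (3 - s < 3)%N by lia.
have := @lucas3 (m %/ 3 + i + j) (i + j - h).-1 (m %% 3) (3 - s) (ltn_pmod m (isT : 0 < 3)%N) s3'.
rewrite (_ : (3 * (_ + _ + _) + _ = m + 3 * i + 3 * j)%N); last by lia.
rewrite (_ : (3 * (i + j - h).-1 + (3 - s) = 3 * i + 3 * j - (3 * h + s))%N); last by lia.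
by move=> H; rewrite -!mulnA !mulnA -(mulnA ('C(h, i) * _)); do !apply: eqn_modM.
Qed.

(** * The lift from parameter [l2 / 3] to [l2] *)

Section Lift.
Variables (F : fieldType) (l2 m : nat).
Notation A := (schur F l2 m).
Notation b := (sb F l2 m).

(** Gathers the digits [s = 1, 2] of [bcoef_mul3_digit]: the coefficient of [b s] is
    [C(m %% 3, 3 - s)]. *)
Definition tshift : A := b 1 *+ 'C(m %% 3, 2) + b 2 *+ (m %% 3).

Variables (e : A) (m' : nat).

Definition lift3 (x : schur F (l2 %/ 3) m') : A :=
  e * \sum_(i < (l2 %/ 3).+1) cf x i *: b (3 * i).

Lemma lift3_is_linear : linear lift3.
Proof.
move=> c x y; rewrite /lift3 scalerAr -mulrDr; congr (_ * _).
rewrite scaler_sumr -big_split /=; apply: eq_bigr => i _.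
by rewrite cfD cfZ scalerDl scalerA.
Qed.

HB.instance Definition _ :=
  GRing.isLinear.Build F (schur F (l2 %/ 3) m') A *:%R lift3 lift3_is_linear.

Lemma lift3_sb i : lift3 (sb F (l2 %/ 3) m' i) = e * b (3 * i).
Proof.
rewrite /lift3; congr (_ * _).
(* Past [l2 / 3] both sides are zero, since then [3 * i > l2]. *)
case: (leqP i (l2 %/ 3)) => il; last first.
  rewrite (@sb_gt _ _ m) ?big1 //; last by lia.
  by move=> j _; rewrite cf_sb -1?ltnS // ltn_eqF ?scale0r // (leq_trans (ltn_ord j)).
rewrite (bigD1 (Ordinal (il : (i < (l2 %/ 3).+1)%N))) //= big1 => [|j].
  by rewrite cf_sb // eqxx scale1r addr0.
rewrite -val_eqE /= => /negbTE ji.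
by rewrite cf_sb -1?ltnS // ji scale0r.
Qed.

Lemma lift3_1 : lift3 1 = e.
Proof. by rewrite -sb0 lift3_sb muln0 sb0 mulr1. Qed.

Hypothesis char3 : (3 \in [pchar F])%N.

(** Grouping the product by the last digit [s] of the index and factoring [b (3 * h + s)] as
    [b s * b (3 * h)] leaves [tshift] as the only correction. *)
Lemma sb_mul3M i j : b (3 * i) * b (3 * j) =
  \sum_(h < (l2 %/ 3).+1)
    b (3 * h) * (1 *+ bcoef (m %/ 3) i j h + tshift *+ bcoef_shift (m %/ 3) i j h).
Proof.
rewrite (@sbM _ _ _ _ _ (3 * (l2 %/ 3).+1)); last by lia.
rewrite (big_ord_mul3 _ (fun h => b h *+ bcoef m (3 * i) (3 * j) h)).
apply: eq_bigr => h _.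
rewrite (mulrn_mod3 char3 _ (bcoef_mul3 m i j h)).
rewrite (mulrn_mod3 char3 _ (bcoef_mul3_digit m i j h (isT : 0 < 1 < 3)%N)).
rewrite (mulrn_mod3 char3 _ (bcoef_mul3_digit m i j h (isT : 0 < 2 < 3)%N)).
rewrite -!(sb_digitM _ _ char3) // bin1.
rewrite /tshift mulrDr mulrnAr mulr1 -addrA; congr (_ + _).
by rewrite mulrnDl -!mulrnA mulrDr !mulrnAr !(mulrC (b (3 * h))) !(mulnC (bcoef_shift _ _ _ _)).
Qed.

(** Later [tau] is the carry of [m %% 3 + 2 * s] for a digit [s]. *)
Variable tau : nat.
Hypotheses (tau1 : (tau <= 1)%N) (Em' : m' = (m %/ 3 + tau)%N).
Hypotheses (ee : e * e = e) (et : e * tshift = e *+ tau).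

(* [tshift] acts on [e] as [tau], and by Pascal's rule
   [bcoef + tau * bcoef_shift] is the structure constant for [m / 3 + tau]. *)
Lemma lift3_sbM i j : lift3 (sb F _ m' i * sb F _ m' j) =
  lift3 (sb F _ m' i) * lift3 (sb F _ m' j).
Proof.
rewrite !lift3_sb mulrACA ee sb_mul3M (@sbM _ _ _ _ _ (l2 %/ 3).+1); last by lia.
rewrite raddf_sum mulr_sumr; apply: eq_bigr => h _ /=.
rewrite raddfMn /= lift3_sb mulrCA mulrDr !mulrnAr mulr1 et -mulrnA -mulrnDr.
rewrite mulrnAr mulrC; congr (_ *+ _).
rewrite Em'; case: (tau) tau1 => [|[|//]] _; first by rewrite mul0n !addn0.
by rewrite addn1 bcoefSm mul1n.
Qed.

Lemma lift3M x y : lift3 (x * y) = lift3 x * lift3 y.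
Proof.
rewrite (sb_expand x (ltnSn _)) (sb_expand y (ltnSn _)).
rewrite mulr_suml !raddf_sum mulr_suml; apply: eq_bigr => i _ /=.
rewrite mulr_sumr !raddf_sum mulr_sumr; apply: eq_bigr => j _ /=.
by rewrite -scalerAl -scalerAr !linearZ /= lift3_sbM -scalerAl -scalerAr.
Qed.

Lemma lift3_absorb x : e * lift3 x = lift3 x.
Proof. by rewrite /lift3 mulrA ee. Qed.

End Lift.

(** * Scalar action up to Frobenius powers *)

Section FrobeniusScalar.
Variables (F : fieldType) (A : comAlgType F).
Hypothesis char3 : (3 \in [pchar A])%N.
Implicit Types e x y : A.

(* A large Frobenius power kills the radical, so this says that [x] acts on
   [e A] as a scalar modulo nilpotents; unlike the latter it is visibly
   stable under sums. *)
Definition frob_scalar e x := exists k c, e * x ^+ (3 ^ k) = c *: e.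

Lemma frob_scalar_raise e x k c n : e * e = e -> e * x ^+ (3 ^ k) = c *: e ->
  e * x ^+ (3 ^ (k + n)) = c ^+ (3 ^ n) *: e.
Proof.
move=> ee H; rewrite expnD exprM.
have : (0 < 3 ^ n)%N by rewrite expn_gt0.
case: (3 ^ n)%N => // d _; elim: d => [|d IH]; first by rewrite !expr1.
rewrite exprS mulrA H -scalerAl IH scalerA -exprS //.
Qed.

Lemma frob_scalar_common e x y : e * e = e -> frob_scalar e x -> frob_scalar e y ->
  exists k c d, e * x ^+ (3 ^ k) = c *: e /\ e * y ^+ (3 ^ k) = d *: e.
Proof.
move=> ee [k [c H]] [l [d H']].
exists (k + l)%N, (c ^+ (3 ^ l)), (d ^+ (3 ^ k)); split.
  exact: frob_scalar_raise.
by rewrite addnC; exact: frob_scalar_raise.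
Qed.

(** Once the exponents agree, the Frobenius power is additive in characteristic 3. *)
Lemma frob_scalarD e x y : e * e = e ->
  frob_scalar e x -> frob_scalar e y -> frob_scalar e (x + y).
Proof.
move=> ee Hx Hy; have [k [c [d [H1 H2]]]] := frob_scalar_common ee Hx Hy.
exists k, (c + d); rewrite exprDn_pchar; last first.
  by rewrite pnatX pnatE // char3.
by rewrite mulrDr H1 H2 scalerDl.
Qed.

Lemma frob_scalarM e x y : e * e = e ->
  frob_scalar e x -> frob_scalar e y -> frob_scalar e (x * y).
Proof.
move=> ee Hx Hy; have [k [c [d [H1 H2]]]] := frob_scalar_common ee Hx Hy.
by exists k, (c * d); rewrite exprMn mulrA H1 -scalerAl H2 scalerA.
Qed.

Lemma frob_scalarZ e x a : frob_scalar e x -> frob_scalar e (a *: x).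
Proof.
move=> [k [c H]]; exists k, (a ^+ (3 ^ k) * c).
by rewrite exprZn -scalerAr H scalerA.
Qed.

Lemma frob_scalar_sum e n (f : nat -> A) : e * e = e ->
  (forall i, frob_scalar e (f i)) -> frob_scalar e (\sum_(i < n) f i).
Proof.
move=> ee H; elim: n => [|n IH].
  by exists 0%N, 0; rewrite big_ord0 expr1 mulr0 scale0r.
by rewrite big_ord_recr; exact: frob_scalarD.
Qed.

(** An idempotent equals its own powers, so [f = c *: e]; if [c] is nonzero,
    [c *: f = f * f = f = c *: e] allows cancelling [c]. *)
Lemma frob_scalar_idem e f : e * f = f -> f * f = f -> frob_scalar e f ->
  e * e = e -> f = 0 \/ f = e.
Proof.
move=> ef ff [k [c H]] ee.
have Hf : f = c *: e.
  rewrite -H; have : (0 < 3 ^ k)%N by rewrite expn_gt0.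
  case: (3 ^ k)%N => // d _; elim: d => [|d IH]; first by rewrite expr1 ef.
  by rewrite exprS mulrCA -IH ff.
case: (eqVneq c 0) => [c0|c0]; first by left; rewrite Hf c0 scale0r.
right; apply: (scalerI c0).
by rewrite -Hf -{1}ef scalerAl -Hf ff.
Qed.

End FrobeniusScalar.

(** * Arithmetic of the last digit *)

Section Digits.
Variables (F : fieldType) (l2 m : nat).
Hypothesis char3 : (3 \in [pchar F])%N.
Notation A := (schur F l2 m).
Notation b := (sb F l2 m).

(** Natural coefficients reduce identities between such elements to finite computations modulo 3. *)
Definition trinom (u : nat) (c : nat * nat * nat) : A :=
  1 *+ c.1.1 + b (3 ^ u) *+ c.1.2 + b (2 * 3 ^ u) *+ c.2.

Definition eqmod3 (c d : nat * nat * nat) :=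
  [&& c.1.1 %% 3 == d.1.1 %% 3, c.1.2 %% 3 == d.1.2 %% 3 & c.2 %% 3 == d.2 %% 3]%N.

Lemma trinom_eqmod3 u c d : eqmod3 c d -> trinom u c = trinom u d.
Proof.
move=> /and3P[/eqP h1 /eqP h2 /eqP h3].
by congr (_ + _ + _); apply: mulrn_mod3.
Qed.

(* Structure constants of the span of [1], [b(1)], [b(2)], for [m = m0] mod 3. *)
Definition trimul (m0 : nat) (c d : nat * nat * nat) : nat * nat * nat :=
  (c.1.1 * d.1.1,
   c.1.1 * d.1.2 + c.1.2 * d.1.1 + (m0 + 2) * (c.1.2 * d.1.2),
   c.1.1 * d.2 + c.2 * d.1.1 + c.1.2 * d.1.2
     + (2 * m0) * (c.1.2 * d.2 + c.2 * d.1.2) + (m0 == 1) * (c.2 * d.2))%N.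

Lemma trinomD u c d : trinom u c + trinom u d =
  trinom u (c.1.1 + d.1.1, c.1.2 + d.1.2, c.2 + d.2)%N.
Proof. rewrite /trinom /= !mulrnDr; ring. Qed.

Lemma sb11 : b 1 * b 1 = b 2 + b 1 *+ (m %% 3 + 2).
Proof.
rewrite (@sbM _ _ _ _ _ 3) ?gtn_min ?orbT // !big_ord_recr big_ord0 /= /bcoef /=.
rewrite !bin1 bin0 (@mulrn_mod3 _ char3 _ (b 2) _ 1) //.
rewrite (@mulrn_mod3 _ char3 _ (b 1) _ (m %% 3 + 2)) ?addr0 ?add0r 1?addrC //.
by rewrite -addnA modnDml; congr (_ %% _)%N; lia.
Qed.

Lemma sb12 : b 1 * b 2 = b 2 *+ (2 * (m %% 3)).
Proof.
rewrite (@sbM _ _ _ _ _ 4) ?gtn_min ?orbT // !big_ord_recr big_ord0 /= /bcoef /=.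
rewrite !bin1 bin0 (@mulrn_mod3 _ char3 _ (b 3) _ 0) //.
rewrite (@mulrn_mod3 _ char3 _ (b 2) _ (2 * (m %% 3))) ?addr0 ?add0r //.
by rewrite binn; lia.
Qed.

Lemma sb22 : b 2 * b 2 = b 2 *+ (m %% 3 == 1)%N.
Proof.
rewrite (@sbM _ _ _ _ _ 5) ?gtn_min ?orbT // !big_ord_recr big_ord0 /= /bcoef /=.
rewrite !bin1 bin0 (@mulrn_mod3 _ char3 _ (b 3) _ 0) //; last by rewrite -modnMml.
rewrite (@mulrn_mod3 _ char3 _ (b 4) _ 0) //.
rewrite (@mulrn_mod3 _ char3 _ (b 2) _ (m %% 3 == 1)%N) ?addr0 ?add0r //.
have m3 : (m %% 3 < 3)%N by rewrite ltn_mod.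
(* The coefficient of [b 2] is [C(m + 4, 2)]; splitting off the last digit of [m + 4] shows by Lucas
   that it survives only for [m = 1] mod 3. *)
have Em : (m + 2 + 2 = 3 * (m %/ 3 + (m %% 3 == 2)).+1
    + (if m %% 3 == 2 then 0 else (m %% 3).+1))%N.
  by case: eqP => ?; lia.
have := @lucas3 (m %/ 3 + (m %% 3 == 2)).+1%N 0
  (if m %% 3 == 2 then 0 else (m %% 3).+1)%N 2.
rewrite muln0 add0n -Em bin0 mul1n binn !mul1n (_ : 2 + 2 - 2 = 2)%N // => ->//; last by case: eqP => ?; lia.
by case: (m %% 3)%N m3 => [|[|[|]]].
Qed.

Lemma trinomM c d : trinom 0 c * trinom 0 d = trinom 0 (trimul (m %% 3) c d).
Proof.
rewrite /trinom /= expn0 muln1.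
have := sb11; have := sb12; have := sb22.
set p := b 1; set q := b 2; move: (m %% 3)%N => m0 qq pq pp.
rewrite !(mulrDl, mulrDr) !(mulrnAl, mulrnAr) !mul1r !mulr1 (mulrC q p) qq pq pp.
rewrite !(mulrnDr, mulrnDl) -!mulrnA; ring.
Qed.

End Digits.

(* [efactor] at the digits [a] of [m + 2g] and [c] of [g] is the [trinom] with
   these coefficients, [-1] being written [2]. *)
Definition dcoef (a c : nat) : nat * nat * nat :=
  if (c == 0%N) && (a == 0%N) then (1, 1, 2)%N
  else if (c == 1%N) && (a == 2%N) then (0, 2, 1)%N
  else if (c == 0%N) && (a == 1%N) then (1, 0, 2)%N
  else if (c == 2%N) && (a == 2%N) then (0, 0, 1)%N
  else if (c == 0%N) && (a == 2%N) then (1, 2, 1)%N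
  else if (c == 1%N) && (a == 1%N) then (0, 1, 2)%N
  else (1, 0, 0)%N.

Definition nondiv (m g : nat) : bool := ~~ (3 %| 'C(m + 2 * g, g))%N.

(** Lucas' condition on the last digit: [C(a, s)] is nonzero mod 3, where [a] is the last digit of
    [m + 2s]. *)
Definition gooddig (m s : nat) : bool := (s <= (m %% 3 + 2 * s) %% 3)%N.

(** The six pairs correspond to the six index sets in the definition of [e_{m,g}]. *)
Lemma gooddig_cases m s (P : nat -> nat -> Prop) :
  (s < 3)%N -> gooddig m s ->
  P 0%N 0%N -> P 0%N 1%N -> P 1%N 0%N -> P 1%N 2%N -> P 2%N 0%N -> P 2%N 1%N ->
  P (m %% 3)%N s.
Proof.
rewrite /gooddig; have : (m %% 3 < 3)%N by rewrite ltn_mod.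
by case: (m %% 3)%N s => [|[|[|//]]] [|[|[|//]]].
Qed.

(** Here [m + 2 (3h + s)] has the last digit of [m + 2s] and quotient [(m + 2s) / 3 + 2h], so Lucas
    leaves the same condition for the smaller pair. *)
Lemma nondiv_digit m h s : (s < 3)%N ->
  nondiv m (3 * h + s) = gooddig m s && nondiv ((m + 2 * s) %/ 3) h.
Proof.
move=> s3; rewrite /nondiv.
have := @lucas3 ((m + 2 * s) %/ 3 + 2 * h) h ((m + 2 * s) %% 3) s.
rewrite (_ : (3 * _ + _ = m + 2 * (3 * h + s))%N); last by lia.
rewrite ltn_mod => /(_ isT s3) H.
rewrite /dvdn H -/(dvdn _ _) Euclid_dvdM // negb_or andbC; congr (_ && _).
rewrite /gooddig modnDml.
have : ((m + 2 * s) %% 3 < 3)%N by rewrite ltn_mod.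
move: {H} ((m + 2 * s) %% 3)%N => a.
by case: a s s3 => [|[|[|//]]] [|[|[|//]]].
Qed.

Lemma nondiv0 m : nondiv m 0.
Proof. by rewrite /nondiv bin0. Qed.

Section DigitIdempotents.
Variable F : fieldType.
Hypothesis char3 : (3 \in [pchar F])%N.

Section Factors.
Variables (l2 m : nat).
Notation A := (schur F l2 m).
Notation b := (sb F l2 m).

Lemma oppr_mul2 (x : A) : - x = x *+ 2.
Proof. by apply/eqP; rewrite -subr_eq0 -opprD oppr_eq0 -mulrS mulr3n_eq0. Qed.

Lemma efactorE g u : (efactor F l2 m g u : A) =
  trinom F l2 m u (dcoef (dig3 u (m + 2 * g)) (dig3 u g)).
Proof.
rewrite /efactor /dcoef /trinom.
have N (x : SF F l2) : - x = x *+ 2 by exact: oppr_mul2.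
by do ![case: ifP => _ /=]; rewrite ?N ?mulr0n ?mulr1n ?addr0 ?add0r // addrC.
Qed.

Definition edig (s : nat) : A := trinom F l2 m 0 (dcoef ((m %% 3 + 2 * s) %% 3) s).

Lemma efactor0 g : (efactor F l2 m g 0 : A) = edig (g %% 3).
Proof.
rewrite efactorE /edig /dig3 expn0 !divn1; congr (trinom _ _ _ _ (dcoef _ _)).
lia.
Qed.

Lemma trinomMn u c n : trinom F l2 m u c *+ n =
  trinom F l2 m u (c.1.1 * n, c.1.2 * n, c.2 * n)%N.
Proof. by rewrite /trinom !mulrnDl -!mulrnA. Qed.

Lemma sb1E : b 1 = trinom F l2 m 0 (0, 1, 0)%N.
Proof. by rewrite /trinom /= !mulr0n addr0 add0r. Qed.

Lemma sb2E : b 2 = trinom F l2 m 0 (0, 0, 1)%N.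
Proof. by rewrite /trinom /= !mulr0n !add0r. Qed.

Lemma edig_idem s : (s < 3)%N -> gooddig m s -> edig s * edig s = edig s.
Proof.
move=> s3 gs; rewrite /edig (trinomM _ _ char3); apply: (trinom_eqmod3 _ _ char3).
by pattern (m %% 3)%N, s; apply: (gooddig_cases s3 gs).
Qed.

(** Supplies the hypothesis [et] of the lift, the scalar being the carry of the last digit. *)
Lemma edig_tshift s : (s < 3)%N -> gooddig m s ->
  edig s * tshift F l2 m = edig s *+ ((m %% 3 + 2 * s) %/ 3).
Proof.
move=> s3 gs.
have -> : tshift F l2 m = trinom F l2 m 0 (0, 'C(m %% 3, 2), m %% 3)%N.
  by rewrite /tshift /trinom /= mulr0n add0r.
rewrite /edig (trinomM _ _ char3) trinomMn; apply: (trinom_eqmod3 _ _ char3).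
by pattern (m %% 3)%N, s; apply: (gooddig_cases s3 gs).
Qed.

Lemma edig_orth s t : (s < 3)%N -> (t < 3)%N -> gooddig m s -> gooddig m t ->
  s != t -> edig s * edig t = 0.
Proof.
move=> s3 t3 gs gt st.
have -> : 0 = trinom F l2 m 0 (0, 0, 0)%N by rewrite /trinom /= !mulr0n !addr0.
rewrite /edig (trinomM _ _ char3); apply: (trinom_eqmod3 _ _ char3).
move: gt t3 st; rewrite /gooddig.
pattern (m %% 3)%N, s; refine (gooddig_cases s3 gs _ _ _ _ _ _); by case: t => [|[|[|]]].
Qed.

End Factors.
End DigitIdempotents.

(** * The digit recursion and leading terms *)

Section DigitRecursion.
Variable F : fieldType.
Hypothesis char3 : (3 \in [pchar F])%N.

Section Factors.
Variables (l2 m : nat).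
Notation A := (schur F l2 m).
Notation b := (sb F l2 m).
Notation edig := (edig F l2 m).

Lemma edig_frob s t : (s < 3)%N -> gooddig m s -> (t < 3)%N -> frob_scalar (edig s) (b t).
Proof.
move=> s3 gs t3.
suff [n Hn] : exists n, edig s * b t ^+ 3 = edig s *+ n.
  by exists 1%N, n%:R; rewrite scaler_nat expn1.
have cube d : (exists n, eqmod3
     (trimul (m %% 3) (dcoef ((m %% 3 + 2 * s) %% 3) s)
        (trimul (m %% 3) d (trimul (m %% 3) d d)))
     (let c := dcoef ((m %% 3 + 2 * s) %% 3) s in (c.1.1 * n, c.1.2 * n, c.2 * n))%N) ->
  exists n, edig s * trinom F l2 m 0 d ^+ 3 = edig s *+ n.
  move=> [n Hn]; exists n.
  rewrite /edig !exprS expr0 mulr1 !(trinomM _ _ char3) trinomMn.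
  exact: trinom_eqmod3.
case: t t3 => [|[|[|//]]] _; first by exists 1%N; rewrite sb0 expr1n mulr1.
  rewrite sb1E; apply: cube; pattern (m %% 3)%N, s.
  by refine (gooddig_cases s3 gs _ _ _ _ _ _);
    (* The cube acts on [edig s] as a residue mod 3; each candidate is tried by computation. *)
    (exists 0%N + exists 1%N + exists 2%N).
rewrite sb2E; apply: cube; pattern (m %% 3)%N, s.
by refine (gooddig_cases s3 gs _ _ _ _ _ _);
  (exists 0%N + exists 1%N + exists 2%N).
Qed.

(** For each residue of [m] exactly two digits are admissible, and their factors are
    complementary. *)
Lemma edig_sum : (if gooddig m 0 then edig 0 else 0) + (if gooddig m 1 then edig 1 else 0)
  + (if gooddig m 2 then edig 2 else 0) = 1.
Proof.
have E0 : 0 = trinom F l2 m 0 (0, 0, 0)%N by rewrite /trinom /= !mulr0n !addr0.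
have E1 : 1 = trinom F l2 m 0 (1, 0, 0)%N by rewrite /trinom /= !mulr0n !addr0.
rewrite /edig /gooddig [in RHS]E1.
have : (m %% 3 < 3)%N by rewrite ltn_mod.
by case: (m %% 3)%N => [|[|[|//]]] _ /=; rewrite E0 !trinomD; apply: trinom_eqmod3.
Qed.

Definition digcoef (c : nat * nat * nat) (t : nat) : nat :=
  if t == 0%N then c.1.1 else if t == 1%N then c.1.2 else c.2.

Lemma cf_lift3 m' c (x : schur F (l2 %/ 3) m') h t : (t < 3)%N -> (3 * h + t <= l2)%N ->
  cf (lift3 (trinom F l2 m 0 c) x) (3 * h + t) = cf x h *+ digcoef c t.
Proof.
move=> t3 hl; rewrite /lift3 mulr_sumr cf_sum.
have hN : (h < (l2 %/ 3).+1)%N by lia.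
have K i : trinom F l2 m 0 c * b (3 * i) =
    b (3 * i) *+ c.1.1 + b (3 * i + 1) *+ c.1.2 + b (3 * i + 2) *+ c.2.
  by rewrite /trinom expn0 muln1 !mulrDl !mulrnAl mul1r !(sb_digitM _ _ char3).
have C i : cf (trinom F l2 m 0 c * b (3 * i)) (3 * h + t) = (digcoef c t * (i == h))%:R.
  rewrite K !cfD !cfMn !cf_sb // -!mulrnA -!mulrnDr; congr (_ *+ _).
  by rewrite /digcoef; case: t t3 {hl} => [|[|[|//]]] _; case: (eqVneq i h) => [->|ih] /=; lia.
rewrite (bigD1 (Ordinal hN)) //= -scalerAr cfZ C eqxx muln1 mulr_natr big1 ?addr0 // => i.
by rewrite -val_eqE /= -scalerAr cfZ C => /negbTE->; rewrite muln0 mulr0.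
Qed.

End Factors.

(** Beyond the bound, [3 ^ u] exceeds [m + 2g] and [l2], so digits and basis elements vanish and the
    factor is 1. Products of different lengths become comparable. *)
Lemma e_mg_prod l2 m g N : (m + 2 * g + l2 + 1 <= N)%N ->
  (e_mg F l2 m g : schur F l2 m) = \prod_(u < N) (efactor F l2 m g u : schur F l2 m).
Proof.
move=> leN; rewrite -(subnKC leN) big_split_ord /= [X in _ * X]big1 ?mulr1 // => i _.
set u := (_ + _ + i)%N.
have lt : (u < 3 ^ u)%N by exact: ltn_expl.
have D n : (n <= u)%N -> dig3 u n = 0%N.
  by move=> nu; rewrite /dig3 divn_small ?mod0n // (leq_ltn_trans nu).
rewrite efactorE // !D /u; try lia.
rewrite -/u /trinom !sb_gt ?mul0rn ?addr0 //; rewrite /u in lt *; lia.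
Qed.

Lemma lift3_mul_sb l2 m m' (e : schur F l2 m) (tau : nat) :
  (tau <= 1)%N -> m' = (m %/ 3 + tau)%N -> e * e = e ->
  e * tshift F l2 m = e *+ tau ->
  forall (x : schur F (l2 %/ 3) m') i,
  lift3 e x * sb F l2 m (3 * i) = lift3 e (x * sb F _ m' i).
Proof.
move=> t1 Em ee et x i; rewrite (lift3M char3 t1 Em ee et) lift3_sb.
by rewrite mulrA (mulrC _ e) (lift3_absorb ee).
Qed.

Lemma efactorS l2 m g u h s : (s < 3)%N -> g = (3 * h + s)%N ->
  let c := dcoef (dig3 u ((m + 2 * s) %/ 3 + 2 * h)) (dig3 u h) in
  (efactor F l2 m g u.+1 : schur F l2 m) = trinom F l2 m u.+1 c.
Proof.
move=> s3 ->; rewrite efactorE //; congr (trinom _ _ _ _ (dcoef _ _)).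
  by rewrite /dig3 expnS divnMA; congr ((_ %/ _) %% _)%N; lia.
by rewrite /dig3 expnS divnMA; congr ((_ %/ _) %% _)%N; lia.
Qed.

(** The factor at [u = 0] is [edig s]; the factor at [u + 1] is, after multiplication by [edig s],
    the lift of the factor at [u] for the smaller parameters. *)
Lemma e_mg_rec l2 m h s : (s < 3)%N -> gooddig m s ->
  (e_mg F l2 m (3 * h + s) : schur F l2 m) =
  lift3 (edig F l2 m s) (e_mg F (l2 %/ 3) ((m + 2 * s) %/ 3) h : schur F _ ((m + 2 * s) %/ 3)).
Proof.
move=> s3 gs; set m' := ((m + 2 * s) %/ 3)%N; set e := edig F l2 m s.
have tau1 : ((m %% 3 + 2 * s) %/ 3 <= 1)%N.
  by pattern (m %% 3)%N, s; refine (gooddig_cases s3 gs _ _ _ _ _ _).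
have Em' : m' = (m %/ 3 + (m %% 3 + 2 * s) %/ 3)%N by rewrite /m'; lia.
have ee : e * e = e by exact: edig_idem.
have et := edig_tshift char3 l2 s3 gs.
(* Large enough for the product formulas on both sides. *)
pose N := (m + 2 * (3 * h + s) + l2 + m' + 2 * h + l2 %/ 3 + 1)%N.
rewrite (@e_mg_prod _ _ _ N.+1) ?(@e_mg_prod _ _ _ N); try (rewrite /N; lia).
rewrite big_ord_recl efactor0 // (_ : (3 * h + s) %% 3 = s)%N; last by lia.
rewrite -/e; elim: N => [|N IH]; first by rewrite !big_ord0 lift3_1 mulr1.
rewrite !big_ord_recr mulrA IH (lift3M char3 tau1 Em' ee et).
rewrite -{1}(lift3_absorb ee) (mulrC e) -mulrA; congr (_ * _).
rewrite [X in e * X](efactorS _ _ _ s3 (erefl _)) efactorE // -/m' /trinom.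
rewrite !raddfD !raddfMn /= !lift3_sb muln0 sb0 !mulrDr !mulrnAr.
by rewrite -expnS mulnCA -expnS.
Qed.

(** The [b(i)] with [i > 0] span an ideal: [bcoef m i j 0] vanishes unless [i = j = 0]. *)
Lemma cf0M l2 m (x y : schur F l2 m) : cf (x * y) 0 = cf x 0 * cf y 0.
Proof.
rewrite (sb_expand x (ltnSn _)) (sb_expand y (ltnSn _)).
rewrite mulr_suml !cf_sum mulr_suml; apply: eq_bigr => i _.
rewrite mulr_sumr !cf_sum mulr_sumr; apply: eq_bigr => j _.
rewrite -scalerAl -scalerAr !cfZ cf_sbM // !cf_sb // mulrACA -natrM mulrA.
congr (_ * _%:R); rewrite /bcoef leq0n !bin0n -!(eq_sym 0%N).
by case: (nat_of_ord i) => [|?]; case: (nat_of_ord j) => [|?] //=; rewrite ?mul0n ?muln0 // subnn bin0.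
Qed.

Lemma cf_e_mg0 l2 m : cf (e_mg F l2 m 0 : schur F l2 m) 0 = 1.
Proof.
rewrite (e_mg_prod (leqnn _)); move: (m + 2 * 0 + l2 + 1)%N => N.
elim: N => [|N IH]; first by rewrite big_ord0 -sb0 cf_sb.
rewrite big_ord_recr cf0M IH mul1r efactorE // /trinom !cfD !cfMn -sb0 !cf_sb //.
have -> : dig3 N 0 = 0%N by rewrite /dig3 div0n.
rewrite eqxx !(eq_sym 0%N) !eqn0Ngt !expn_gt0 muln_gt0 expn_gt0 /= !mul0rn !addr0.
have : (dig3 N (m + 2 * 0) < 3)%N by rewrite ltn_mod.
by case: (dig3 N _) => [|[|[|//]]].
Qed.

(** By [e_mg_rec], coordinates factor over digits: the quotient is handled by induction, and the
    last-digit factor starts exactly at [b(s)]. *)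
Lemma cf_e_mg_lead l2 m g : nondiv m g ->
  (forall h, (h < g)%N -> cf (e_mg F l2 m g : schur F l2 m) h = 0) /\
  ((g <= l2)%N -> cf (e_mg F l2 m g : schur F l2 m) g != 0).
Proof.
elim/ltn_ind: g l2 m => g IH l2 m; have [->|g0] := posnP g.
  by move=> _; split=> // _; rewrite cf_e_mg0 oner_eq0.
have s3 : (g %% 3 < 3)%N by rewrite ltn_mod.
have Eg : g = (3 * (g %/ 3) + g %% 3)%N by lia.
rewrite {1 2 3 4 5 6}Eg; move: (g %/ 3)%N (g %% 3)%N s3 Eg => k s s3 Eg.
rewrite nondiv_digit // => /andP[gs nd]; rewrite e_mg_rec //.
have kg : (k < g)%N by lia.
have [L1 L2] := IH k kg (l2 %/ 3)%N _ nd.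
have dlow t : (t < s)%N -> digcoef (dcoef ((m %% 3 + 2 * s) %% 3) s) t = 0%N.
  by pattern (m %% 3)%N, s; refine (gooddig_cases s3 gs _ _ _ _ _ _); case: t => [|[|]].
have dlead : ~~ (3 %| digcoef (dcoef ((m %% 3 + 2 * s) %% 3) s) s)%N.
  by pattern (m %% 3)%N, s; refine (gooddig_cases s3 gs _ _ _ _ _ _).
split=> [h hg | gl].
  case: (leqP h l2) => hl; last by rewrite cf_gt.
  have t3 : (h %% 3 < 3)%N by rewrite ltn_mod.
  rewrite (_ : h = 3 * (h %/ 3) + h %% 3)%N; last by lia.
  rewrite cf_lift3 //; last by lia.
  case: (ltngtP (h %/ 3) k) => [lt|gt|E]; first by rewrite L1 // mul0rn.
    by lia.
  by rewrite dlow ?mulr0n //; lia.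
rewrite cf_lift3 // -mulr_natr mulf_neq0 ?L2 //; first by lia.
by rewrite -(dvdn_pcharf char3).
Qed.

Lemma e_mg_gt l2 m g : nondiv m g -> (l2 < g)%N -> (e_mg F l2 m g : schur F l2 m) = 0.
Proof.
move=> nd lg; have [L _] := cf_e_mg_lead l2 nd.
by apply: cf_inj => h hl; rewrite cf0 L // (leq_ltn_trans hl).
Qed.

End DigitRecursion.

(** * Idempotency, orthogonality, completeness and primitivity *)

Section Main.
Variable F : fieldType.
Hypothesis char3 : (3 \in [pchar F])%N.
Notation e l2 m g := (e_mg F l2 m g : schur F l2 m).

Lemma gooddig_tau m s : (s < 3)%N -> gooddig m s -> ((m %% 3 + 2 * s) %/ 3 <= 1)%N.
Proof.
by move=> s3 gs; pattern (m %% 3)%N, s; refine (gooddig_cases s3 gs _ _ _ _ _ _).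
Qed.

Lemma divn3_tau m s : ((m + 2 * s) %/ 3 = m %/ 3 + (m %% 3 + 2 * s) %/ 3)%N.
Proof. lia. Qed.

Lemma lift3_edigM l2 m s (s3 : (s < 3)%N) (gs : gooddig m s) :
  {morph @lift3 F l2 m (edig F l2 m s) ((m + 2 * s) %/ 3) : x y / x * y >-> x * y}.
Proof.
apply: (lift3M char3 (gooddig_tau s3 gs) (divn3_tau m s)).
  exact: edig_idem.
exact: edig_tshift.
Qed.

(** The descent stops at [l2 = 0], where the algebra is the field itself. *)
Lemma nondiv_ind (P : nat -> nat -> nat -> Prop) :
  (forall m g, nondiv m g -> P 0%N m g) ->
  (forall l2 m h s, (0 < l2)%N -> (s < 3)%N -> gooddig m s ->
     nondiv ((m + 2 * s) %/ 3) h -> P (l2 %/ 3)%N ((m + 2 * s) %/ 3)%N h ->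
     P l2 m (3 * h + s)%N) ->
  forall l2 m g, nondiv m g -> P l2 m g.
Proof.
move=> P0 PS; elim/ltn_ind => l2 IH m g; have [->|l2gt] := posnP l2; first exact: P0.
rewrite (_ : g = 3 * (g %/ 3) + g %% 3)%N; last by lia.
have s3 : (g %% 3 < 3)%N by rewrite ltn_mod.
rewrite nondiv_digit // => /andP[gs nd]; apply: PS => //; apply: IH => //; lia.
Qed.

Lemma schur0_scalar m (x : schur F 0 m) : x = cf x 0 *: 1.
Proof. by rewrite [LHS](sb_expand x (ltnSn 0)) big_ord1. Qed.

Lemma e_mg00 m : e 0 m 0 = 1.
Proof. by rewrite [LHS]schur0_scalar cf_e_mg0 // scale1r. Qed.

Lemma e_mg_idem l2 m g : nondiv m g -> e l2 m g * e l2 m g = e l2 m g.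
Proof.
elim/nondiv_ind: l2 m g / => [m [|g] nd|l2 m h s _ s3 gs nd IH].
- by rewrite e_mg00 mulr1.
- by rewrite e_mg_gt // mulr0.
- by rewrite e_mg_rec // -lift3_edigM // IH.
Qed.

Lemma e_mg_orth l2 m g g' : nondiv m g -> nondiv m g' -> g != g' ->
  e l2 m g * e l2 m g' = 0.
Proof.
move=> nd; move: nd g'.
elim/nondiv_ind: l2 m g / => [m g nd|l2 m h s _ s3 gs nd IH] g' nd' gg'.
  case: g nd gg' => [|g] nd gg'; last by rewrite e_mg_gt // mul0r.
  by rewrite (@e_mg_gt _ char3 _ _ g') ?mulr0 // lt0n eq_sym.
have t3 : (g' %% 3 < 3)%N by rewrite ltn_mod.
have Eg : g' = (3 * (g' %/ 3) + g' %% 3)%N by lia.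
move: Eg t3; move: (g' %/ 3)%N (g' %% 3)%N => k t Eg t3.
move: nd' gg'; rewrite {}Eg nondiv_digit // => /andP[gt ndk] gg'.
rewrite !e_mg_rec //.
(* Equal last digits reduce to the quotients by the lift; distinct ones give orthogonal digit
   factors. *)
have [Est|st] := eqVneq s t.
  subst t; rewrite -lift3_edigM // IH ?raddf0 //.
  by apply: contra gg' => /eqP->.
by rewrite /lift3 mulrACA edig_orth // mul0r.
Qed.

Lemma e_mg_sum l2 m : \sum_(g < l2.+1 | nondiv m g) e l2 m g = 1.
Proof.
elim/ltn_ind: l2 m => l2 IH m; have [l20|l2gt] := posnP l2.
  move: IH; rewrite {}l20 => _.
  by rewrite big_mkcond big_ord1 nondiv0 e_mg00.
pose f g : schur F l2 m := if nondiv m g then e l2 m g else 0.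
(* Padding to a multiple of 3 adds only zeros by [e_mg_gt], so the sum splits by last digit. *)
have -> : \sum_(g < l2.+1 | nondiv m g) e l2 m g = \sum_(g < 3 * (l2 %/ 3).+1) f g.
  rewrite big_mkcond (big_ord_widen_cond _ predT f (_ : l2.+1 <= 3 * (l2 %/ 3).+1)%N) /=;
    last by lia.
  rewrite big_mkcond; apply: eq_bigr => g _; case: ifP => // gl.
  by rewrite /f; case: ifP => // nd; rewrite e_mg_gt // ltnNge -ltnS gl.
have S s : (s < 3)%N -> \sum_(h < (l2 %/ 3).+1) f (3 * h + s)%N =
    if gooddig m s then edig F l2 m s else 0.
  move=> s3; case: ifP => gs; last first.
    by rewrite big1 // => h _; rewrite /f nondiv_digit // gs.
  rewrite -[RHS](lift3_1 _ ((m + 2 * s) %/ 3)) -IH; last by lia.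
  rewrite raddf_sum [RHS]big_mkcond; apply: eq_bigr => h _ /=.
  by rewrite /f nondiv_digit // gs /=; case: ifP => // nd; rewrite e_mg_rec.
rewrite big_ord_mul3 !big_split /= -edig_sum // -(S 1%N) // -(S 2%N) //.
congr (_ + _ + _); rewrite -[RHS](S 0%N isT).
by apply: eq_bigr => h _; rewrite addn0.
Qed.

(** Since [frob_scalar] respects sums, products and scaling, it suffices to treat [b(t)] with
    [t < 3], by [edig_frob], and [b(3i)], by induction through the lift. *)
Lemma e_mg_frob l2 m g : nondiv m g -> forall x, frob_scalar (e l2 m g) x.
Proof.
elim/nondiv_ind: l2 m g / => [m g nd x|l2 m h s _ s3 gs nd IH x].
  by exists 0%N, (cf x 0); rewrite expr1 {1}[x]schur0_scalar -scalerAr mulr1.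
have nde : nondiv m (3 * h + s) by rewrite nondiv_digit // gs.
have ee := e_mg_idem l2 nde.
rewrite (sb_expand x (ltnSn _)).
apply: (@frob_scalar_sum _ _ (schur_pchar l2 m char3) _ _ (fun i => cf x i *: sb F l2 m i)) => // i.
apply: frob_scalarZ.
rewrite (_ : i = 3 * (i %/ 3) + i %% 3)%N; last by lia.
have t3 : (i %% 3 < 3)%N by rewrite ltn_mod.
rewrite -sb_digitM //; apply: frob_scalarM => //.
  have [k [c H]] := edig_frob char3 l2 s3 gs t3.
  exists k, c; rewrite e_mg_rec // -(lift3_absorb (edig_idem char3 l2 s3 gs)).
  by rewrite mulrAC H -scalerAl.
have [k [c H]] := IH (sb F _ _ (i %/ 3)).
exists k, c; rewrite e_mg_rec // -linearZ /= -H.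
elim: (3 ^ k)%N => [|n IHn]; first by rewrite !expr0 !mulr1.
rewrite !exprSr !mulrA IHn (lift3_mul_sb char3 (gooddig_tau s3 gs) (divn3_tau m s)) //.
  exact: edig_idem.
exact: edig_tshift.
Qed.

Lemma e_mg_primitive l2 m g : nondiv m g -> (g <= l2)%N -> primitive_idem m (e_mg F l2 m g).
Proof.
move=> nd gl; have ee := e_mg_idem l2 nd.
split=> //.
  have [_ /(_ gl)] := cf_e_mg_lead char3 l2 nd.
  by apply: contraNneq => E; rewrite [X in cf X _](E : _ = 0 :> schur F l2 m) cf0.
move=> f1 f2 i1 _ f12 _ Ee.
(* A summand [f] of an orthogonal splitting is an idempotent fixed by [e_{m,g}], hence 0 or all of
   it. *)
have key (f f' : schur F l2 m) : f * f = f -> f * f' = 0 -> e l2 m g = f + f' ->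
    f = 0 \/ f' = 0.
  move=> ff ff' Ef.
  have ef : e l2 m g * f = f by rewrite mulrC Ef mulrDr ff ff' addr0.
  have [->|fe] := frob_scalar_idem ef ff (e_mg_frob nd f) ee; first by left.
  by right; apply: (addrI f); rewrite -Ef addr0.
exact: key i1 f12 Ee.
Qed.

End Main.

Unset Implicit Arguments.

Theorem theorem1p2 (F : fieldType) (r l1 l2 : nat) :
  (3 \in [pchar F])%N -> (l2 <= l1)%N -> (l1 + l2)%N = r ->
  let m := (l1 - l2)%N in
  let G := [seq g <- iota 0 l2.+1 | ~~ (3 %| 'C(m + 2 * g, g))%N] in
  [/\ (forall g, g \in G -> primitive_idem m (e_mg F l2 m g)),
      (forall g g' : nat, g \in G -> g' \in G -> g != g' ->
         smul m (e_mg F l2 m g) (e_mg F l2 m g') = 0) &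
      (\sum_(g <- G) (e_mg F l2 m g : SF F l2))%R = sone F l2].
Proof.
move=> char3 _ _ m G.
have GE g : (g \in G) = nondiv m g && (g <= l2)%N.
  by rewrite mem_filter mem_iota add0n ltnS.
split=> [g|g g'|].
- by rewrite GE => /andP[nd gl]; exact: e_mg_primitive.
- by rewrite !GE => /andP[nd _] /andP[nd' _]; exact: e_mg_orth.
- transitivity (\sum_(0 <= g < l2.+1 | nondiv m g) (e_mg F l2 m g : SF F l2)).
    by rewrite /G big_filter /index_iota subn0.
  by rewrite big_mkord; exact: e_mg_sum.
Qed.
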